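(* Let $\Omega\subset\mathbb{R}^2$ be a bounded strictly convex domain whose boundary $\partial\Omega$ has curvature $\kappa>0$, let $a>0$ and let $H\in\mathbb{R}$. If $H<1$ and $u>0$ is a solution of $$\mathrm{div}\left(\frac{Du}{\sqrt{1+|Du|^2}}\right)=-\frac{2}{u}\left(\frac{1}{\sqrt{1+|Du|^2}}-H\right)\ \text{ in }\Omega,\qquad u=a\ \text{ on }\partial\Omega,$$ then $$u_M\geq\frac{1-H}{\kappa_0},$$ where $u_M=\sup_\Omega u$ and $\kappa_0=\max_{\partial\Omega}\kappa$.
   Context: Here $D$ and $\mathrm{div}$ are the Euclidean gradient and divergence in $\mathbb{R}^2$, $|\cdot|$ is the Euclidean norm, and $\kappa$ is the Euclidean curvature of the planar curve $\partial\Omega$ (with the sign convention that it is positive on round circles). A solution of the Dirichlet problem is a smooth function $u>0$ in $\Omega$ satisfying the equation in $\Omega$ and the boundary condition on $\partial\Omega$. *)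

(* Defs.v *)
From HB Require Import structures.
From mathcomp Require Import all_boot all_order all_algebra.
From mathcomp Require Import all_classical all_reals all_analysis.
Set Implicit Arguments.
Unset Strict Implicit.
Unset Printing Implicit Defensive.
Import Order.TTheory GRing.Theory Num.Theory.
Import numFieldNormedType.Exports.
Local Open Scope classical_set_scope.
Local Open Scope ring_scope.

(* The library norm `|v| on 'rV[R]_n is the sup norm; the Euclidean norm is   *)
(* therefore defined here.                                                    *)
Definition dot (R : realType) (n : nat) (v w : 'rV[R]_n) : R :=
  \sum_(i < n) v 0 i * w 0 i.

Definition enorm (R : realType) (n : nat) (v : 'rV[R]_n) : R :=
  Num.sqrt (dot v v).

Definition partial (R : realType) (n : nat) (i : 'I_n.+1)
    (f : 'rV[R]_n.+1 -> R) (x : 'rV[R]_n.+1) : R :=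
  'D_(delta_mx 0 i) f x.

Definition grad (R : realType) (n : nat) (f : 'rV[R]_n.+1 -> R)
    (x : 'rV[R]_n.+1) : 'rV[R]_n.+1 :=
  \row_i partial i f x.

Definition divergence (R : realType) (n : nat)
    (F : 'rV[R]_n.+1 -> 'rV[R]_n.+1) (x : 'rV[R]_n.+1) : R :=
  \sum_i partial i (fun y => F y 0 i) x.

(* C^oo on an open set: the iterated partial derivatives of all orders exist  *)
(* and are Frechet differentiable (hence continuous) at every point of A.     *)
Definition smooth_on (R : realType) (n : nat) (A : set 'rV[R]_n.+1)
    (f : 'rV[R]_n.+1 -> R) : Prop :=
  forall (s : seq 'I_n.+1) (x : 'rV[R]_n.+1),
    A x -> differentiable (foldr (@partial R n) f s) x.

Definition boundary (T : topologicalType) (A : set T) : set T :=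
  closure A `\` interior A.

Definition domain (T : topologicalType) (A : set T) : Prop :=
  [/\ open A, connected A & A !=set0].

Definition strictly_convex (R : realType) (n : nat)
    (A : set 'rV[R]_n.+1) : Prop :=
  forall (x y : 'rV[R]_n.+1) (t : R),
    closure A x -> closure A y -> x != y -> 0 < t < 1 ->
    interior A (t *: x + (1 - t) *: y).

(* Counterclockwise rotation by a right angle: (x, y) |-> (- y, x).           *)
Definition rot90 (R : realType) (v : 'rV[R]_2) : 'rV[R]_2 :=
  \row_i (if i == 0 then - v 0 1 else v 0 0).

(* g is an l-periodic, regular, simple C^2 parametrization of the boundary of *)
(* A, oriented so that rot90 (derive1 g t) points into A.                     *)
Definition boundary_param (R : realType) (A : set 'rV[R]_2)
    (g : R -> 'rV[R]_2) (l : R) : Prop :=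
  [/\ [/\ 0 < l, periodic g l &
          forall s t, 0 <= s < l -> 0 <= t < l -> g s = g t -> s = t],
      [/\ forall t, derivable g t 1,
          forall t, derivable (derive1 g) t 1,
          continuous (derive1 (derive1 g)) &
          forall t, derive1 g t != 0],
      range g = boundary A &
      forall t, \forall s \near 0^'+, A (g t + s *: rot90 (derive1 g t))].

(* <g'', N> / |g'|^2 with N := rot90 g' / |g'|. For a boundary_param, N is    *)
(* the inward unit normal, so round circles have positive curvature.          *)
Definition curvature (R : realType) (g : R -> 'rV[R]_2) (t : R) : R :=
  dot (derive1 (derive1 g) t) (rot90 (derive1 g t)) / enorm (derive1 g t) ^+ 3.

(* The supremum is a maximum, see max_curvature_attained.                     *)
Definition max_curvature (R : realType) (g : R -> 'rV[R]_2) : R :=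
  sup (range (curvature g)).

Definition solves_equation (R : realType) (A : set 'rV[R]_2) (H : R)
    (u : 'rV[R]_2 -> R) : Prop :=
  forall x, A x ->
    divergence
      (fun y => (Num.sqrt (1 + enorm (grad u y) ^+ 2))^-1 *: grad u y) x
    = - (2 / u x) * ((Num.sqrt (1 + enorm (grad u x) ^+ 2))^-1 - H).

(* Du is not assumed to extend continuously to the boundary.                  *)
Definition dirichlet_solution (R : realType) (A : set 'rV[R]_2) (H a : R)
    (u : 'rV[R]_2 -> R) : Prop :=
  [/\ smooth_on A u,
      {within closure A, continuous u},
      forall x, A x -> 0 < u x,
      solves_equation A H u &
      forall x, boundary A x -> u x = a].

Section max_curvature.
Variables (R : realType) (A : set 'rV[R]_2) (g : R -> 'rV[R]_2) (l : R).
Hypothesis gP : boundary_param A g l.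

Let derive1_periodic (f : R -> 'rV[R]_2) :
  periodic f l -> periodic (derive1 f) l.
Proof.
move=> fl t; rewrite /derive1 fl.
by under eq_fun do rewrite addrA fl.
Qed.

Let curvature_periodic : periodic (curvature g) l.
Proof.
have [[_ gl _] _ _ _] := gP.
by move=> t; rewrite /curvature !derive1_periodic//; exact: derive1_periodic.
Qed.

Let coord_cont (f : R -> 'rV[R]_2) (i : 'I_2) :
  continuous f -> continuous (fun t => f t 0 i).
Proof.
move=> cf t; apply: (@continuous_comp _ _ _ f (fun M : 'rV[R]_2 => M 0 i)).
  exact: cf.
exact: coord_continuous.
Qed.

Let curvature_continuous : continuous (curvature g).
Proof.
have [_ [_ dg' cg'' g'0] _ _] := gP.
have cg' : continuous (derive1 g).
  by move=> t; apply/differentiable_continuous/derivable1_diffP/dg'.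
have dotE (v w : 'rV[R]_2) : dot v w = v 0 0 * w 0 0 + v 0 1 * w 0 1.
  by rewrite /dot !big_ord_recl big_ord0 addr0; congr (_ + v 0 _ * w 0 _);
     exact/val_inj.
have dot_rot90 (v w : 'rV[R]_2) :
    dot v (rot90 w) = v 0 0 * - w 0 1 + v 0 1 * w 0 0.
  by rewrite dotE !mxE.
have cdot (f h : R -> 'rV[R]_2) : continuous f -> continuous h ->
    continuous (fun t => dot (f t) (h t)).
  move=> cf ch t; rewrite /continuous_at dotE.
  under eq_fun do rewrite dotE.
  by apply: cvgD; apply: cvgM; apply: coord_cont.
have cdotr (f h : R -> 'rV[R]_2) : continuous f -> continuous h ->
    continuous (fun t => dot (f t) (rot90 (h t))).
  move=> cf ch t; rewrite /continuous_at dot_rot90.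
  under eq_fun do rewrite dot_rot90.
  by apply: cvgD; apply: cvgM; try apply: cvgN; apply: coord_cont.
have enorm_neq0 (v : 'rV[R]_2) : v != 0 -> enorm v != 0.
  apply: contra; rewrite /enorm sqrtr_eq0 => le0; apply/eqP/rowP => i.
  have sq0 (j : 'I_2) : true -> 0 <= v 0 j * v 0 j.
    by move=> _; rewrite -expr2 sqr_ge0.
  have /eqP : dot v v = 0 by apply/eqP; rewrite eq_le le0 sumr_ge0.
  rewrite /dot psumr_eq0// => /allP/(_ i (mem_index_enum _)).
  by rewrite mxE mulf_eq0 orbb => /eqP.
have cenorm (f : R -> 'rV[R]_2) : continuous f ->
    continuous (fun t => enorm (f t)).
  move=> cf t; rewrite /enorm.
  apply: (continuous_comp (f := fun s => dot (f s) (f s))); first exact: cdot.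
  exact: sqrt_continuous.
have quot (p q : R -> R) : continuous p -> continuous q ->
    (forall t, q t != 0) -> continuous (fun t => p t / q t ^+ 3).
  move=> cp cq q0 t; apply: cvgM; first exact: cp.
  apply: cvgV; first by rewrite expf_neq0.
  exact: (continuous_comp (cq t) (@exprn_continuous _ 3 _)).
apply: quot; [exact: cdotr | exact: cenorm | by move=> t; exact: enorm_neq0].
Qed.

Lemma max_curvature_attained :
  (exists t, curvature g t = max_curvature g) /\
  (forall t, curvature g t <= max_curvature g).
Proof.
have [[l0 _ _] _ _ _] := gP.
have [c _ cmax] : exists2 c, c \in `[0, l] &
    forall t, t \in `[0, l] -> curvature g t <= curvature g c.
  apply: EVT_max (ltW l0) _; exact: continuous_subspaceT.
have perz (k : int) t : curvature g (t + k%:~R * l) = curvature g t.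
  have pern (m : nat) s : curvature g (s + m%:R * l) = curvature g s.
    elim: m => [|m IHm]; first by rewrite mul0r addr0.
    by rewrite -natr1 mulrDl mul1r addrA curvature_periodic.
  case: k => m; first exact: pern.
  rewrite NegzE mulrNz mulNr -(pern m.+1 (t - _)) -pmulrn.
  by rewrite subrK.
have ub t : curvature g t <= curvature g c.
  pose k := Num.floor (t / l).
  rewrite -(perz (- k) t); apply: cmax.
  rewrite in_itv/= mulrNz mulNr subr_ge0 -ler_pdivlMr// floor_le/=.
  have lE : l + k%:~R * l = (1 + k%:~R) * l by rewrite mulrDl mul1r.
  rewrite lerBlDr lE -ler_pdivrMr// addrC ltW//.
  by have := floorD1_gt (t / l); rewrite intrD.
have mE : max_curvature g = curvature g c.
  apply/eqP; rewrite eq_le; apply/andP; split.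
    apply: ge_sup; first by exists (curvature g c); exists c.
    by move=> _ [t _ <-].
  apply: ub_le_sup; last by exists c.
  by exists (curvature g c) => _ [t _ <-].
by split=> [|t]; [exists c | rewrite mE].
Qed.

End max_curvature.

(* Main.v *)
Require Import Defs.
From mathcomp Require Import all_boot all_order all_algebra.
From mathcomp Require Import all_classical all_reals all_analysis.
From mathcomp Require Import ring lra.
Import Order.TTheory GRing.Theory Num.Theory.
Import numFieldNormedType.Exports.
Local Open Scope classical_set_scope.
Local Open Scope ring_scope.

(** The equation says that the graph of [u] has constant mean curvature [H] in
    the upper half-space model of hyperbolic space.  Round spheres are
    umbilical there: the upper cap

      [v x = Num.sqrt (rho ^+ 2 - |x - x0|^2) - h * rho]

    solves the same equation with [h] in place of [H], for every radius
    [rho > 0], and the caps of different radii are dilations of one another.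
    The height of the cap over its centre is [(1 - h) * rho].

    Take [h > H].  A cap cannot touch the graph of [u] from below
    ([cap_contact]): at an interior contact point the gradients agree and the
    Hessian of [u] dominates that of the cap, so the left-hand side of the
    equation is at least [- 2 / rho], whereas its right-hand side is smaller
    because [H < h]; on the rim the cap is vertical and [u] is not.  So, if
    the disc of radius [r] about [x0] lies in the domain, the caps of radius
    [rho] growing from [0] to [r] all stay below the graph, as very small ones
    do ([sweep_caps]), and [(1 - h) * r < u x0].

    By Blaschke's rolling theorem the domain contains discs of every radius
    [r] with [r * kappa < 1] along the boundary ([inner_disc]).  Indeed, let
    [X = g + r nu] be the inner parallel curve, [nu] being the inward unit
    normal.  Its derivative is [(1 - r kappa) g'], so the height of [X] in the
    direction [nu t] has the same critical points as that of [g], namely the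
    points whose tangent is parallel to [g' t]; as [kappa > 0], those with
    normal [- nu t] are strict local maxima, so the minimum is attained at [t]
    ([parallel_height_min]).  Hence [X 0] lies at distance at least [r] inside
    every supporting line of the domain, and so does not leave the domain when
    moved by less than [r].

    The theorem follows on letting [h] tend to [H] and [r] to the inverse of
    the maximal curvature. *)

Set Implicit Arguments.
Unset Strict Implicit.
Unset Printing Implicit Defensive.

(** * Derivatives of functions of one real variable *)

Lemma is_derive_gt0_right (R : realType) (f : R -> R) (x c : R) :
  is_derive x 1 f c -> 0 < c -> \forall t \near x^'+, f x < f t.
Proof.
move=> fc c0; apply/nbhs_right0P.
have /cvgr_gt : h^-1 *: (f (h *: 1 + x) - f x) @[h --> (0:R)^'+] --> c.
  by apply: cvg_dnbhs_at_right; case: fc => + <-.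
move=> /(_ 0 c0) fpos; near=> h.
have h0 : 0 < h by near: h; exact: nbhs_right_gt.
have : 0 < h^-1 *: (f (h *: 1 + x) - f x) by near: h.
rewrite [h *: 1]mulr1 [x + h]addrC /GRing.scale/=.
by rewrite pmulr_rgt0 ?invr_gt0// subr_gt0.
Unshelve. all: by end_near. Qed.

Lemma is_derive_gt0_left (R : realType) (f : R -> R) (x c : R) :
  is_derive x 1 f c -> 0 < c -> \forall t \near x^'-, f t < f x.
Proof.
move=> fc c0; apply/nbhs_left0P.
have /cvgr_gt : h^-1 *: (f (h *: 1 + x) - f x) @[h --> (0:R)^'-] --> c.
  by apply: cvg_dnbhs_at_left; case: fc => + <-.
move=> /(_ 0 c0)/nbhs_left0P fpos; near=> h.
have h0 : 0 < h by near: h; exact: nbhs_right_gt.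
have : 0 < (0 - h)^-1 *: (f ((0 - h) *: 1 + x) - f x) by near: h.
rewrite sub0r [(- h) *: 1]mulr1 [x - h]addrC /GRing.scale/=.
by rewrite invrN mulNr -mulrN opprB pmulr_rgt0 ?invr_gt0// subr_gt0.
Unshelve. all: by end_near. Qed.

Lemma derive_gt0_right_lt (R : realType) (f df : R -> R) (x : R) :
  (\forall t \near (x : R), is_derive (t : R) 1 f (df t)) ->
  (\forall t \near x^'+, 0 < df t) ->
  \forall t \near x^'+, f x < f t.
Proof.
move=> fdf; rewrite /at_right near_withinE => df0.
have /nbhs_ballP[e /= e0 fe] := fdf.
have /nbhs_ballP[d /= d0 dfd] := df0.
apply/nbhs_ballP; exists (Num.min e d) => /=; first by rewrite lt_min e0.
move=> t /=; rewrite /ball/= lt_min => /andP[te td] xt.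
have near_x y : y \in `[x, t] -> `|x - y| <= `|x - t|.
  by rewrite in_itv/= => /andP[? ?]; rewrite !ler0_norm ?subr_le0//; lra.
have fd y : y \in `[x, t] -> is_derive y 1 f (df y).
  move=> yxt; apply: fe; rewrite /ball_/=.
  exact: le_lt_trans (near_x _ yxt) te.
have fdo y : y \in `]x, t[ -> is_derive y 1 f (df y).
  by move=> yxt; apply: fd; exact: subset_itv_oo_cc.
have fc : {within `[x, t], continuous f}.
  by apply: derivable_within_continuous => y /fd fy; exact: ex_derive.
have [c cxt fE] := MVT xt fdo fc.
rewrite -subr_gt0 fE mulr_gt0 ?subr_gt0//.
apply: dfd; last by move: cxt; rewrite in_itv => /andP[].
by apply: le_lt_trans td; apply: near_x; exact: subset_itv_oo_cc.
Qed.

Lemma local_min_second_order (R : realType) (f df : R -> R) (x c : R) :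
  (\forall t \near (x : R), is_derive (t : R) 1 f (df t)) ->
  is_derive x 1 df c ->
  (\forall t \near (x : R), f x <= f t) -> df x = 0 /\ 0 <= c.
Proof.
move=> fdf dfc fmin.
have fx : is_derive x 1 f (df x) by exact: nbhs_singleton fdf.
have contra (F : set_system R) : ProperFilter F -> F --> x ->
    (\forall t \near F, f t < f x) -> False.
  move=> FF Fx flt; near F => t.
  have : f x <= f t by near: t; exact: Fx.
  by rewrite leNgt => /negP; apply; near: t.
have df0 : df x = 0.
  apply/eqP; rewrite eq_le !leNgt; apply/andP; split; apply/negP => df0.
    have := is_derive_gt0_left fx df0.
    by apply: contra; exact: cvg_within.
  have := is_derive_gt0_right (is_deriveN fx).
  rewrite oppr_gt0 => /(_ df0) Nf.
  apply: (contra x^'+); first exact: cvg_within.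
  by apply: filterS Nf => t; rewrite !fctE ltrN2.
split=> //; rewrite leNgt; apply/negP => c0.
have := is_derive_gt0_right (is_deriveN dfc).
rewrite oppr_gt0 => /(_ c0) dfNlt.
have fN : \forall t \near (x : R), is_derive (t : R) 1 (- f) ((- df) t).
  by apply: filterS fdf => t; exact: is_deriveN.
have dfN : \forall t \near x^'+, 0 < (- df) t.
  by apply: filterS dfNlt => t; rewrite !fctE df0 oppr0.
apply: (contra x^'+); first exact: cvg_within.
apply: filterS (derive_gt0_right_lt fN dfN) => t.
by rewrite !fctE ltrN2.
Unshelve. all: by end_near. Qed.

(** The derivation rules are restated for pointwise expressions, so that the
    function derived need not first be written with operations on functions. *)

Lemma is_derive_add (R : realType) (f g : R -> R) (t a b : R) :
  is_derive t 1 f a -> is_derive t 1 g b ->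
  is_derive t 1 (fun s => f s + g s) (a + b).
Proof. exact: is_deriveD. Qed.

Lemma is_derive_mul (R : realType) (f g : R -> R) (t a b : R) :
  is_derive t 1 f a -> is_derive t 1 g b ->
  is_derive t 1 (fun s => f s * g s) (f t * b + g t * a).
Proof. exact: is_deriveM. Qed.

Lemma is_derive_const (R : realType) (t c : R) :
  is_derive t 1 (fun _ : R => c) 0.
Proof. exact: is_derive_cst. Qed.

Lemma is_derive_scalel (R : realType) (f : R -> R) (t a c : R) :
  is_derive t 1 f a -> is_derive t 1 (fun s => c * f s) (c * a).
Proof.
move=> fa; have := is_derive_mul (is_derive_const t c) fa.
by rewrite mulr0 addr0.
Qed.

Lemma is_derive_sqr (R : realType) (f : R -> R) (t a : R) :
  is_derive t 1 f a -> is_derive t 1 (fun s => f s ^+ 2) (2 * (f t * a)).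
Proof.
move=> fa; have -> : (fun s => f s ^+ 2) = (fun s => f s * f s).
  by apply/funext => s; rewrite expr2.
by rewrite mulr_natl mulr2n; exact: is_derive_mul.
Qed.

(** With [e = 1] this differentiates the components of [Du] divided by the
    area element of the graph, with [e = 0] those of a unit normal. *)
Lemma is_derive_over_slope (R : realType) (e : R) (p q f : R -> R)
    (a b c t : R) :
  0 < e + (p t ^+ 2 + q t ^+ 2) ->
  is_derive t 1 p a -> is_derive t 1 q b -> is_derive t 1 f c ->
  let w s := Num.sqrt (e + (p s ^+ 2 + q s ^+ 2)) in
  is_derive t 1 (fun s => (w s)^-1 * f s)
    (c / w t - f t * (p t * a + q t * b) / w t ^+ 3).
Proof.
move=> S0 pa qb fc w.
have w0 : w t != 0 by rewrite lt0r_neq0// sqrtr_gt0.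
pose S s : R := e + (p s ^+ 2 + q s ^+ 2).
have Sd : is_derive t 1 S (2 * (p t * a + q t * b)).
  rewrite mulrDr -[_ + _]add0r.
  by apply: is_derive_add (is_derive_const _ _) _; apply: is_derive_add;
    exact: is_derive_sqr.
have wd : is_derive t 1 w
    ((2 * Num.sqrt (S t))^-1 * (2 * (p t * a + q t * b))).
  exact: (@is_derive1_comp R Num.sqrt S t _ _ (is_derive1_sqrt S0) Sd).
apply: is_derive_eq (is_deriveM (is_deriveV w0 wd) fc) _.
rewrite /GRing.scale/= -/(w t); field; exact: w0.
Qed.

Lemma periodic_min (R : realType) (f : R -> R) (l : R) : 0 < l ->
  periodic f l -> continuous f -> exists c, forall t, f c <= f t.
Proof.
move=> l0 fl cf.
have [c _ cmin] : exists2 c, c \in `[0, l] &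
    forall t, t \in `[0, l] -> f c <= f t.
  by apply: EVT_min (ltW l0) _; exact: continuous_subspaceT.
exists c => t; pose k := Num.floor (t / l).
have pern (m : nat) s : f (s + m%:R * l) = f s.
  elim: m => [|m IHm]; first by rewrite mul0r addr0.
  by rewrite -natr1 mulrDl mul1r addrA fl.
have perz (j : int) s : f (s + j%:~R * l) = f s.
  case: j => m; first exact: pern.
  by rewrite NegzE mulrNz mulNr -(pern m.+1 (s - _)) -pmulrn subrK.
rewrite -(perz (- k) t); apply: cmin.
rewrite in_itv/= mulrNz mulNr subr_ge0 -ler_pdivlMr// floor_le/=.
have lE : l + k%:~R * l = (1 + k%:~R) * l by rewrite mulrDl mul1r.
rewrite lerBlDr lE -ler_pdivrMr// addrC ltW//.
by have := floorD1_gt (t / l); rewrite intrD.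
Qed.

(** * Coordinates, lines and partial derivatives *)

Lemma sum2E (R : realType) (F : 'I_2 -> R) : \sum_i F i = F 0 + F 1.
Proof.
by rewrite !big_ord_recl big_ord0 addr0; congr (_ + F _); exact/val_inj.
Qed.

Lemma dot2E (R : realType) (v w : 'rV[R]_2) :
  dot v w = v 0 0 * w 0 0 + v 0 1 * w 0 1.
Proof. exact: sum2E. Qed.

Lemma ord2P (i : 'I_2) : i = 0 \/ i = 1.
Proof. by case: i => -[|[|//]] ?; [left|right]; exact/val_inj. Qed.

Lemma row2P (R : realType) (v w : 'rV[R]_2) :
  v 0 0 = w 0 0 -> v 0 1 = w 0 1 -> v = w.
Proof. by move=> e0 e1; apply/rowP => i; have [->|->] := ord2P i. Qed.

Lemma rot90E0 (R : realType) (v : 'rV[R]_2) : rot90 v 0 0 = - v 0 1.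
Proof. by rewrite mxE. Qed.

Lemma rot90E1 (R : realType) (v : 'rV[R]_2) : rot90 v 0 1 = v 0 0.
Proof. by rewrite mxE. Qed.

Lemma dot_ge0 (R : realType) (v : 'rV[R]_2) : 0 <= dot v v.
Proof. by rewrite dot2E -!expr2 addr_ge0// sqr_ge0. Qed.

Lemma sqr_enorm (R : realType) (v : 'rV[R]_2) :
  enorm v ^+ 2 = v 0 0 ^+ 2 + v 0 1 ^+ 2.
Proof. by rewrite /enorm sqr_sqrtr ?dot_ge0// dot2E -!expr2. Qed.

Lemma sqdist_continuous (R : realType) (x0 : 'rV[R]_2) :
  continuous (fun y : 'rV[R]_2 => dot (y - x0) (y - x0)).
Proof.
pose f (i : 'I_2) (z : 'rV[R]_2) : R := z 0 i - x0 0 i.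
have cf (i : 'I_2) : continuous (f i).
  have c : continuous (fun z : 'rV[R]_2 => z 0 i) by exact: coord_continuous.
  by move=> z; apply: continuousB; [exact: c|exact: cst_continuous].
have -> : (fun y : 'rV[R]_2 => dot (y - x0) (y - x0)) =
    f 0 * f 0 + f 1 * f 1.
  by apply/funext => y; rewrite dot2E !mxE.
move=> y; exact: (continuousD (continuousM (cf 0 y) (cf 0 y))
                              (continuousM (cf 1 y) (cf 1 y))).
Qed.

Lemma line_continuous (R : realType) (n : nat) (x d : 'rV[R]_n.+1) :
  continuous (fun t : R => x + t *: d).
Proof.
move=> t; have c : {for t, continuous (fun t : R => t *: d)}.
  exact: scalel_continuous.
exact: (continuousD (@cst_continuous _ _ x t) c).
Qed.

Lemma derive_quotient_line (R : realType) (n : nat) (f : 'rV[R]_n.+1 -> R)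
    (x d : 'rV[R]_n.+1) (t : R) :
  (fun h : R => h^-1 *: (f (x + (h *: (1 : R) + t) *: d) - f (x + t *: d)))
  = (fun h : R => h^-1 *: (f (h *: d + (x + t *: d)) - f (x + t *: d))).
Proof.
apply/funext => h; congr (_ *: (f _ - _)).
by rewrite [h *: 1]mulr1 scalerDl addrCA.
Qed.

Lemma derive_line (R : realType) (n : nat) (f : 'rV[R]_n.+1 -> R)
    (x d : 'rV[R]_n.+1) (t : R) :
  'D_1 (fun s : R => f (x + s *: d)) t = 'D_d f (x + t *: d).
Proof. by rewrite /derive derive_quotient_line. Qed.

Lemma is_derive_line (R : realType) (n : nat) (f : 'rV[R]_n.+1 -> R)
    (x d : 'rV[R]_n.+1) (t : R) : differentiable f (x + t *: d) ->
  is_derive t 1 (fun s => f (x + s *: d))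
    (\sum_i d 0 i * partial i f (x + t *: d)).
Proof.
move=> fd; have := @diff_derivable _ _ _ _ _ d fd.
rewrite /derivable => dl; apply: DeriveDef.
  by rewrite /derivable derive_quotient_line.
rewrite derive_line; move: (x + _) fd {dl} => y fd.
rewrite deriveE// {1}[d]row_sum_delta linear_sum; apply: eq_bigr => i _.
by rewrite linearZ /partial deriveE.
Qed.

Lemma partial_line (R : realType) (n : nat) (f : 'rV[R]_n.+1 -> R)
    (x : 'rV[R]_n.+1) (i : 'I_n.+1) (c : R) :
  is_derive (0 : R) 1 (fun t => f (x + t *: delta_mx 0 i)) c ->
  partial i f x = c.
Proof. by move=> [_ <-]; rewrite derive_line scale0r addr0. Qed.

Lemma is_derive_coord (R : realType) (n : nat) (f : R -> 'rV[R]_n) (t : R)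
    (i : 'I_n) : derivable f t 1 ->
  is_derive t 1 (fun s => f s 0 i) (derive1 f t 0 i).
Proof.
move=> fd; apply: DeriveDef; first exact: (iffLR (derivable_mxP _ _ _) fd).
by rewrite derive1E derive_mx// mxE.
Qed.

Lemma derive1_periodic (R : realType) (n : nat) (f : R -> 'rV[R]_n) (l : R) :
  periodic f l -> periodic (derive1 f) l.
Proof.
move=> fl t; rewrite /derive1 fl.
by under eq_fun do rewrite addrA fl.
Qed.

(** * The mean curvature operator in nondivergence form *)

Lemma mean_curvature_algebra (R : realType) (p q a b c d w3 : R) :
  a * (1 + (p ^+ 2 + q ^+ 2)) / w3 - p * (p * a + q * b) / w3 +
  (d * (1 + (p ^+ 2 + q ^+ 2)) / w3 - q * (p * c + q * d) / w3) =
  ((1 + q ^+ 2) * a + (1 + p ^+ 2) * d - p * q * (b + c)) / w3.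
Proof. move: w3^-1 => w; ring. Qed.

(** Over the common denominator [w ^+ 3], the pure second derivatives have the
    coefficients [w^2 - p^2] and [w^2 - q^2], where [w^2 = 1 + p^2 + q^2]. *)
Lemma divergence_mean_curvature (R : realType) (A : set 'rV[R]_2)
    (u : 'rV[R]_2 -> R) (x : 'rV[R]_2) : smooth_on A u -> A x ->
  let p := partial 0 u x in let q := partial 1 u x in
  let w := Num.sqrt (1 + enorm (grad u x) ^+ 2) in
  divergence
    (fun y => (Num.sqrt (1 + enorm (grad u y) ^+ 2))^-1 *: grad u y) x
  = ((1 + q ^+ 2) * partial 0 (partial 0 u) x
     + (1 + p ^+ 2) * partial 1 (partial 1 u) x
     - p * q * (partial 0 (partial 1 u) x + partial 1 (partial 0 u) x))
    / w ^+ 3.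
Proof.
move=> us Ax p q w.
have eg y : 1 + enorm (grad u y) ^+ 2 =
    1 + (partial 0 u y ^+ 2 + partial 1 u y ^+ 2).
  by rewrite sqr_enorm !mxE.
have pd i j (t : R) : is_derive (0 : R) 1
    (fun t => partial j u (x + t *: delta_mx 0 i)) (partial i (partial j u) x).
  have jd : differentiable (partial j u) (x + 0 *: delta_mx 0 i).
    by rewrite scale0r addr0; exact: (us [:: j] x Ax).
  apply: DeriveDef; last by rewrite derive_line scale0r addr0.
  by have [] := is_derive_line jd.
have W0 : 0 < w.
  by rewrite /w eg sqrtr_gt0 ltr_wpDr// addr_ge0// sqr_ge0.
have key (i j : 'I_2) : partial i (fun y =>
   ((Num.sqrt (1 + enorm (grad u y) ^+ 2))^-1 *: grad u y) 0 j) x =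
   partial i (partial j u) x / w - partial j u x *
   (p * partial i (partial 0 u) x + q * partial i (partial 1 u) x) / w ^+ 3.
  apply: partial_line.
  under eq_fun do rewrite mxE eg mxE.
  have S0 : 0 < 1 + (partial 0 u (x + 0 *: delta_mx 0 i) ^+ 2 +
      partial 1 u (x + 0 *: delta_mx 0 i) ^+ 2).
    by rewrite ltr_wpDr// addr_ge0// sqr_ge0.
  have := is_derive_over_slope S0 (pd i 0 0) (pd i 1 0) (pd i j 0).
  by rewrite /= scale0r addr0 -eg.
have wE : w ^+ 2 = 1 + (p ^+ 2 + q ^+ 2).
  by rewrite sqr_sqrtr ?eg// addr_ge0// addr_ge0// sqr_ge0.
have w0 : w != 0 by rewrite lt0r_neq0.
have divwE (z : R) : z / w = z * (1 + (p ^+ 2 + q ^+ 2)) / w ^+ 3.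
  by rewrite -wE; field.
rewrite /divergence sum2E !key -/p -/q {key}.
clear W0 wE; clearbody p q w.
move: (partial 0 (partial 0 u) x) (partial 0 (partial 1 u) x)
  (partial 1 (partial 0 u) x) (partial 1 (partial 1 u) x) => u00 u01 u10 u11.
rewrite (divwE u00) (divwE u11).
exact: mean_curvature_algebra.
Qed.

(** * Contact with a spherical cap from below *)

Lemma sphere_second_order (R : realType) (U dU : R -> R) (k c b e : R) :
  (\forall t \near (0 : R), is_derive (t : R) 1 U (dU t)) ->
  is_derive (0 : R) 1 dU k ->
  (\forall t \near (0 : R),
     (U 0 + c) ^+ 2 <= (U t + c) ^+ 2 + (2 * b * t + e * t ^+ 2)) ->
  (U 0 + c) * dU 0 + b = 0 /\ 0 <= dU 0 ^+ 2 + (U 0 + c) * k + e.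
Proof.
move=> UdU dUk Umin.
pose G t := (U t + c) ^+ 2 + (2 * b * t + e * t ^+ 2).
pose dG t := 2 * ((U t + c) * dU t) + (2 * b + e * (2 * t)).
have lind (r t : R) : is_derive t 1 (fun s : R => r * s) r.
  by have := is_derive_scalel r (is_derive_id t (1 : R)); rewrite mulr1.
have Ucd (t v : R) : is_derive t 1 U v -> is_derive t 1 (fun s => U s + c) v.
  move=> Uv; rewrite -[v]addr0.
  exact: is_derive_add Uv (is_derive_const _ _).
have GdG : \forall t \near (0 : R), is_derive (t : R) 1 G (dG t).
  apply: filterS UdU => t Ut.
  apply: is_derive_add; first exact: is_derive_sqr (Ucd _ _ Ut).
  apply: is_derive_add => //; apply: is_derive_scalel.
  by have := is_derive_sqr (is_derive_id t (1 : R)); rewrite mulr1.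
have dGk : is_derive (0 : R) 1 dG
    (2 * ((U 0 + c) * k + dU 0 * dU 0) + (0 + e * 2)).
  have U0 := Ucd _ _ (nbhs_singleton UdU).
  exact: is_derive_add (is_derive_scalel 2 (is_derive_mul U0 dUk))
    (is_derive_add (is_derive_const 0 (2 * b)) (is_derive_scalel e (lind 2 0))).
have Gmin : \forall t \near (0 : R), G 0 <= G t.
  by apply: filterS Umin => t; rewrite /G mulr0 expr0n/= !mulr0 !addr0.
have [] := local_min_second_order GdG dGk Gmin.
rewrite /dG; move: (U 0 + c) (dU 0) => s p.
rewrite !mulr0 addr0 => h1 h2; split; first by lra.
by rewrite expr2; lra.
Qed.

(** As long as [u + c >= 0], the upper hemisphere of centre [(x0, - c)] lies
    below the graph of [u] where [(u + c)^2 + |. - x0|^2] is at least its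
    squared radius, so contact is a local minimum of this function.  Working
    with it rather than with the difference of the two graphs avoids
    differentiating a square root that may vanish. *)
Lemma sphere_line_second_order (R : realType) (A : set 'rV[R]_2)
    (u : 'rV[R]_2 -> R) (c : R) (x0 x d : 'rV[R]_2) :
  open A -> smooth_on A u -> A x ->
  (\forall y \near x, (u x + c) ^+ 2 + dot (x - x0) (x - x0) <=
     (u y + c) ^+ 2 + dot (y - x0) (y - x0)) ->
  let p i := partial i u x in
  let D i j := partial i (partial j u) x in
  let gd := d 0 0 * p 0 + d 0 1 * p 1 in
  let hd := d 0 0 * (d 0 0 * D 0 0 + d 0 1 * D 1 0) +
            d 0 1 * (d 0 0 * D 0 1 + d 0 1 * D 1 1) in
  (u x + c) * gd + dot (x - x0) d = 0 /\
  0 <= gd ^+ 2 + (u x + c) * hd + dot d d.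
Proof.
move=> Ao us Ax xmin p D gd hd.
have x0d : x = x + (0 : R) *: d by rewrite scale0r addr0.
have lcts : x + t *: d @[t --> (0 : R)] --> x.
  by rewrite {2}x0d; exact: line_continuous.
have Al : \forall t \near (0 : R), A (x + t *: d).
  by apply: lcts; apply: open_nbhs_nbhs.
pose L (f : 'rV[R]_2 -> R) (t : R) := f (x + t *: d).
pose dU t := d 0 0 * L (partial 0 u) t + d 0 1 * L (partial 1 u) t.
have UdU : \forall t \near (0 : R), is_derive (t : R) 1 (L u) (dU t).
  apply: filterS Al => t At.
  by have := @is_derive_line R 1 u x d t (us [::] _ At); rewrite sum2E.
have Ld j : is_derive (0 : R) 1 (L (partial j u))
    (d 0 0 * D 0 j + d 0 1 * D 1 j).
  have := @is_derive_line R 1 (partial j u) x d 0.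
  rewrite -x0d => /(_ (us [:: j] _ Ax)).
  by rewrite sum2E.
have dUk : is_derive (0 : R) 1 dU hd.
  exact: is_derive_add (is_derive_scalel _ (Ld 0)) (is_derive_scalel _ (Ld 1)).
have Umin : \forall t \near (0 : R), (L u 0 + c) ^+ 2 <=
    (L u t + c) ^+ 2 + (2 * dot (x - x0) d * t + dot d d * t ^+ 2).
  have Lx : \forall t \near (0 : R),
      (u x + c) ^+ 2 + dot (x - x0) (x - x0) <=
      (u (x + t *: d) + c) ^+ 2 + dot (x + t *: d - x0) (x + t *: d - x0).
    exact: lcts _ xmin.
  apply: filterS Lx => t.
  rewrite {1}/L -x0d -lerBrDr => /le_trans; apply.
  rewrite -/(L u t) -addrA lerD2l !dot2E !mxE.
  move: (x 0 0) (x 0 1) (x0 0 0) (x0 0 1) (d 0 0) (d 0 1) => *.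
  by rewrite le_eqVlt; apply/orP; left; apply/eqP; ring.
have [] := sphere_second_order UdU dUk Umin.
by rewrite /dU /L -x0d.
Qed.

(** The data at an interior contact point: [s] is the height over the centre
    of the sphere, [(p, q) = Du], [(X, Y) = x - x0], [dij] the Hessian and
    [w] the area element.  With [J] the rotation by a right angle, the
    coefficient matrix of the mean curvature operator is the identity plus the
    square of [J Du], so the numerator [Q] is the sum of the Hessian evaluated
    on the two basis vectors and on [J Du = (- q, p)]; the three second-order
    inequalities add up to [s Q >= - 2 w^2].  As [s w = rho], comparison with
    the equation leaves [h <= H]. *)
Lemma contact_inequality (R : realType)
    (s p q X Y d00 d01 d10 d11 w rho v h H : R) :
  0 < s -> 0 < rho -> 0 < v -> 0 < w -> v = s - h * rho ->
  s * p + X = 0 -> s * q + Y = 0 -> s ^+ 2 + (X * X + Y * Y) = rho ^+ 2 ->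
  w ^+ 2 = 1 + (p ^+ 2 + q ^+ 2) ->
  0 <= p ^+ 2 + s * d00 + 1 -> 0 <= q ^+ 2 + s * d11 + 1 ->
  0 <= s * (q ^+ 2 * d00 - p * q * (d01 + d10) + p ^+ 2 * d11) +
       (p ^+ 2 + q ^+ 2) ->
  ((1 + q ^+ 2) * d00 + (1 + p ^+ 2) * d11 - p * q * (d01 + d10)) / w ^+ 3
    = - (2 / v) * (w^-1 - H) ->
  h <= H.
Proof.
move=> s0 rho0 v0 w0 vE pE qE sXY wE h1 h2 h3.
set Q := _ + _ - _ => QE.
have swE : s * w = rho.
  apply/eqP; rewrite -(@eqrXn2 _ 2)//; [|by rewrite mulr_ge0// ltW|exact: ltW].
  rewrite exprMn wE -sXY; apply/eqP.
  have -> : X = - (s * p) by lra.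
  have -> : Y = - (s * q) by lra.
  ring.
have sQ : - (2 * w ^+ 2) <= s * Q.
  rewrite wE /Q.
  have -> : s * ((1 + q ^+ 2) * d00 + (1 + p ^+ 2) * d11
                 - p * q * (d01 + d10)) =
    s * d00 + s * d11
    + s * (q ^+ 2 * d00 - p * q * (d01 + d10) + p ^+ 2 * d11) by ring.
  by lra.
have w_neq0 : w != 0 by rewrite lt0r_neq0.
have v_neq0 : v != 0 by rewrite lt0r_neq0.
have vQ : v * Q = - (2 * w ^+ 2) * (1 - H * w).
  have -> : Q = Q / w ^+ 3 * w ^+ 3 by field.
  by rewrite QE; field; rewrite v_neq0 w_neq0.
have : - (2 * w ^+ 2) * v <= s * (- (2 * w ^+ 2) * (1 - H * w)).
  rewrite -vQ; have -> : s * (v * Q) = s * Q * v by ring.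
  by rewrite ler_pM2r.
have ww0 : 0 < 2 * w ^+ 2 by rewrite mulr_gt0// exprn_gt0.
rewrite [s * _]mulrCA !mulNr lerN2 ler_pM2l// vE -swE.
have -> : s * (1 - H * w) = s - H * (s * w) by ring.
rewrite lerD2l lerN2 ler_pM2r//.
by rewrite swE.
Qed.

Section contact.
Variables (R : realType) (A : set 'rV[R]_2) (u : 'rV[R]_2 -> R) (H h rho : R).
Variables (x0 x : 'rV[R]_2).
Hypotheses (Ao : open A) (us : smooth_on A u) (upos : forall y, A y -> 0 < u y).
Hypotheses (ueq : solves_equation A H u) (Ax : A x) (rho0 : 0 < rho).
Hypothesis above : forall y, dot (y - x0) (y - x0) < rho ^+ 2 ->
  rho ^+ 2 <= (u y + h * rho) ^+ 2 + dot (y - x0) (y - x0).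
Hypothesis touch :
  (u x + h * rho) ^+ 2 + dot (x - x0) (x - x0) = rho ^+ 2.

Lemma interior_contact : 0 < u x + h * rho -> h <= H.
Proof.
move=> s0.
have xmin : \forall y \near x, (u x + h * rho) ^+ 2 + dot (x - x0) (x - x0) <=
     (u y + h * rho) ^+ 2 + dot (y - x0) (y - x0).
  have lt : dot (x - x0) (x - x0) < rho ^+ 2.
    by rewrite -touch ltrDr exprn_gt0.
  rewrite touch; near=> y; apply: above; near: y.
  exact: (cvgr_lt _ (@sqdist_continuous _ x0 x) _ lt).
have := ueq Ax; rewrite (divergence_mean_curvature us Ax).
have second d := sphere_line_second_order d Ao us Ax xmin.
have [] := second (delta_mx 0 0).
have [] := second (delta_mx 0 1).
have [_] :=
  second (\row_i (if i == 0 then - partial 1 u x else partial 0 u x)).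
rewrite /= !dot2E !mxE /=.
have : 1 + enorm (grad u x) ^+ 2 = 1 + (partial 0 u x ^+ 2 + partial 1 u x ^+ 2).
  by rewrite sqr_enorm !mxE.
move: touch s0 (upos Ax).
move: (enorm _ ^+ 2) => g2.
rewrite !dot2E !mxE.
move: (x 0 0 - x0 0 0) (x 0 1 - x0 0 1) => X Y.
move: (partial 0 (partial 0 u) x) (partial 0 (partial 1 u) x)
  (partial 1 (partial 0 u) x) (partial 1 (partial 1 u) x) => d00 d01 d10 d11.
move: (partial 0 u x) (partial 1 u x) (u x) => p q v.
rewrite !mul0r !mul1r !mulr0 !mulr1 !addr0 !add0r.
move=> touchx s0 v0 gE h3 qE h2 pE h1.
have W0 : 0 < Num.sqrt (1 + g2).
  by rewrite gE sqrtr_gt0 ltr_wpDr// addr_ge0// sqr_ge0.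
have WE : Num.sqrt (1 + g2) ^+ 2 = 1 + (p ^+ 2 + q ^+ 2).
  by rewrite sqr_sqrtr// gE addr_ge0// addr_ge0// sqr_ge0.
have vE : v = v + h * rho - h * rho by rewrite addrK.
have h3' : 0 <= (v + h * rho) *
    (q ^+ 2 * d00 - p * q * (d01 + d10) + p ^+ 2 * d11) + (p ^+ 2 + q ^+ 2).
  by apply: le_trans h3 _; rewrite le_eqVlt; apply/orP; left; apply/eqP; ring.
exact: (contact_inequality s0 rho0 v0 W0 vE pE qE touchx WE h1 h2 h3').
Unshelve. all: by end_near. Qed.

(** Here [x] is on the rim.  Moving from [x] towards the centre decreases
    [|. - x0|^2] to first order but changes [(u + h * rho)^2], which vanishes
    at [x], only to second order. *)
Lemma boundary_contact : u x + h * rho = 0 -> False.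
Proof.
move=> s0.
have xr : dot (x - x0) (x - x0) = rho ^+ 2.
  by rewrite -touch s0 expr0n/= add0r.
pose d := x0 - x.
pose L t := u (x + t *: d).
have x0d : x = x + (0 : R) *: d by rewrite scale0r addr0.
have L0 : L 0 = u x by rewrite /L -x0d.
have [c Lc] : exists c, is_derive (0 : R) 1 L c.
  by eexists; apply: is_derive_line; rewrite -x0d; exact: (us [::] Ax).
pose G (t : R) := - ((L t + h * rho) ^+ 2 + (1 - t) ^+ 2 * rho ^+ 2).
have Gd : is_derive (0 : R) 1 G (2 * rho ^+ 2).
  have Ld := is_derive_sqr (is_derive_add Lc (is_derive_const _ (h * rho))).
  have Nd : is_derive (0 : R) 1 (fun s : R => 1 - s) (0 - 1).
    exact: is_derive_add (is_derive_const _ _) (is_deriveN (is_derive_id _ _)).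
  have Rd := is_derive_mul (is_derive_sqr Nd) (is_derive_const _ (rho ^+ 2)).
  have := is_deriveN (is_derive_add Ld Rd).
  rewrite L0 s0 => GG; apply: is_derive_eq GG _; ring.
have G0 : 0 < 2 * rho ^+ 2 by rewrite mulr_gt0// exprn_gt0.
have Glt := is_derive_gt0_right Gd G0.
near (0 : R)^'+ => t.
have : G 0 < G t by near: t.
rewrite /G L0 s0 expr0n/= add0r subr0 expr1n mul1r ltrN2.
have t0 : 0 < t by near: t; exact: nbhs_right_gt.
have t1 : t < 1 by near: t; exact: nbhs_right_lt.
have dE : dot (x + t *: d - x0) (x + t *: d - x0) = (1 - t) ^+ 2 * rho ^+ 2.
  rewrite -xr !dot2E !mxE.
  move: (x 0 0) (x 0 1) (x0 0 0) (x0 0 1) => *; ring.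
rewrite -dE ltNge => /negP; apply; apply: above.
by rewrite dE gtr_pMl ?exprn_gt0// expr_lt1//; lra.
Unshelve. all: by end_near. Qed.

Lemma cap_contact : 0 <= u x + h * rho -> h <= H.
Proof.
rewrite le_eqVlt => /predU1P[/esym/boundary_contact//|].
exact: interior_contact.
Qed.

End contact.

(** * Sweeping a disc with growing caps *)

Lemma closure_le0 (T : topologicalType) (R : realType) (K : set T) (f : T -> R)
    (z : T) : closure K z -> {for z, continuous f} ->
  (forall y, K y -> f y <= 0) -> f z <= 0.
Proof.
move=> Kz fz fK; rewrite leNgt; apply/negP => fz0.
have [y [Ky fy]] := Kz _ (cvgr_gt _ fz _ fz0).
by have := fK y Ky; rewrite leNgt fy.
Qed.

(** Were the conclusion false, the set [K] of pairs (radius, base point) at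
    which a cap reaches the graph would be nonempty.  It is compact, and a
    pair of minimal radius in it is a contact from below. *)
Lemma sweep_caps (R : realType) (A : set 'rV[R]_2) (u : 'rV[R]_2 -> R)
    (H h r : R) (x0 : 'rV[R]_2) :
  open A -> smooth_on A u -> (forall y, A y -> 0 < u y) ->
  solves_equation A H u -> H < h -> 0 < r ->
  (forall y, dot (y - x0) (y - x0) <= r ^+ 2 -> A y) ->
  (1 - h) * r < u x0.
Proof.
move=> Ao us upos ueq Hh r0 rA; rewrite ltNge; apply/negP => ux0.
pose N (y : 'rV[R]_2) := dot (y - x0) (y - x0).
have Nc : continuous N by exact: sqdist_continuous.
have N0 y : 0 <= N y by exact: dot_ge0.
have Nx0 : N x0 = 0 by rewrite /N subrr dot2E !mxE !mul0r addr0.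
have uc y : A y -> {for y, continuous u}.
  by move=> Ay; apply: differentiable_continuous; exact: (us [::] y Ay).
pose F (z : R * 'rV[R]_2) := u z.2 + h * z.1 - Num.sqrt (z.1 ^+ 2 - N z.2).
pose K : set (R * 'rV[R]_2) :=
  [set z | [/\ 0 <= z.1, z.1 <= r, N z.2 <= z.1 ^+ 2 & F z <= 0]].
have c1 : continuous (fst : R * 'rV[R]_2 -> R) by move=> z; exact: cvg_fst.
have c2 : continuous (snd : R * 'rV[R]_2 -> 'rV[R]_2) by move=> z; exact: cvg_snd.
have N2c : continuous (fun z : R * 'rV[R]_2 => N z.2).
  by move=> z; apply: (@continuous_comp _ _ _ snd N); [exact: c2|exact: Nc].
have sqc : continuous (fun z : R * 'rV[R]_2 => z.1 ^+ 2).
  move=> z; apply: (@continuous_comp _ _ _ fst (fun t : R => t ^+ 2)).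
    exact: c1.
  exact: exprn_continuous.
have Fc z : A z.2 -> {for z, continuous F}.
  move=> Az.
  have u2c : {for z, continuous (fun z : R * 'rV[R]_2 => u z.2)}.
    by apply: (@continuous_comp _ _ _ snd u); [exact: c2|exact: uc].
  have hc : {for z, continuous (cst h * (fst : R * 'rV[R]_2 -> R))}.
    by apply: continuousM; [exact: cst_continuous|exact: c1].
  have rc : {for z, continuous (fun z : R * 'rV[R]_2 => Num.sqrt (z.1 ^+ 2 - N z.2))}.
    apply: (@continuous_comp _ _ _ (fun z : R * 'rV[R]_2 => z.1 ^+ 2 - N z.2) Num.sqrt).
      exact: (continuousB (sqc z) (N2c z)).
    exact: sqrt_continuous.
  exact: (continuousB (continuousD u2c hc) rc).
have inA z : z.1 <= r -> 0 <= z.1 -> N z.2 <= z.1 ^+ 2 -> A z.2.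
  move=> zr z0 Nz; apply: rA; apply: le_trans Nz _.
  by rewrite ler_sqr ?nnegrE//; exact: ltW.
have Kcl : closed K.
  move=> z Kz.
  have z0 : 0 <= z.1.
    rewrite -oppr_le0; apply: (@closure_le0 _ _ _ (fun z => - z.1) _ Kz).
      exact: (continuousN (c1 z)).
    by move=> y [? _ _ _]; rewrite oppr_le0.
  have zr : z.1 <= r.
    rewrite -subr_le0; apply: (@closure_le0 _ _ _ (fun z => z.1 - r) _ Kz).
      by apply: (continuousB (c1 z)); exact: cst_continuous.
    by move=> y [_ ? _ _]; rewrite subr_le0.
  have zN : N z.2 <= z.1 ^+ 2.
    rewrite -subr_le0.
    apply: (@closure_le0 _ _ _ (fun z : R * 'rV[R]_2 => N z.2 - z.1 ^+ 2) _ Kz).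
      exact: (continuousB (N2c z) (sqc z)).
    by move=> y [_ _ ? _]; rewrite subr_le0.
  split=> //; apply: (@closure_le0 _ _ _ F _ Kz); first exact: Fc (inA _ zr z0 zN).
  by move=> y [].
have Kc : compact K.
  pose box := [set v : 'rV[R]_2 | forall i, `[x0 ord0 i - r, x0 ord0 i + r]%classic (v ord0 i)].
  have cB : compact (`[0, r]%classic `*` box).
    apply: compact_setX; first exact: segment_compact.
    apply: (@rV_compact R 2
      (fun i : 'I_2 => `[x0 ord0 i - r, x0 ord0 i + r]%classic)) => i.
    exact: segment_compact.
  apply: (subclosed_compact Kcl cB) => -[t y] [/= t0 tr Nty _]; split.
    by rewrite /= in_itv/= t0.
  move=> i /=; rewrite in_itv/= -ler_distl -ler_sqr ?nnegrE ?(ltW r0)//.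
  rewrite real_normK ?num_real//.
  apply: (@le_trans _ _ (N y)).
    rewrite /N dot2E !mxE; have [->|->] := ord2P i.
    - by rewrite expr2 lerDl -expr2 sqr_ge0.
    - by rewrite expr2 lerDr -expr2 sqr_ge0.
  by apply: le_trans Nty _; rewrite ler_sqr ?nnegrE// ltW.
have K0 : K !=set0.
  exists (r, x0); split=> //=; first exact: ltW.
    by rewrite Nx0 sqr_ge0.
  by rewrite /F/= Nx0 subr0 sqrtr_sqr ger0_norm ?(ltW r0)//; lra.
have [[rho x] /[!inE] -[/= rho0 rhor Nx Fx] rhomin] :=
  compact_EVT_min K0 Kc (continuous_subspaceT c1).
have Ax : A x by exact: inA (rho, x) _ _ _.
have rho_gt0 : 0 < rho.
  rewrite lt_neqAle rho0 andbT; apply/eqP => rhoE.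
  move: Fx Nx; rewrite /F/= -rhoE expr0n/= mulr0 addr0 => Fx Nx.
  move: Fx; have -> : N x = 0 by apply/eqP; rewrite eq_le Nx N0.
  by rewrite subr0 sqrtr0 subr0 leNgt upos.
(* Caps of smaller radius are below the graph, and so is their limit. *)
have above y : N y < rho ^+ 2 -> Num.sqrt (rho ^+ 2 - N y) <= u y + h * rho.
  move=> Ny; rewrite -subr_ge0 leNgt; apply/negP => Fy.
  have Ay : A y by apply: (inA (rho, y)) => //=; exact: ltW.
  have Ft : {for rho, continuous (fun t => F (t, y))}.
    apply: (@continuous_comp _ _ _ (fun t => (t, y)) F); last exact: Fc.
    exact: (cvg_pair (@cvg_id _ (nbhs rho)) (cvg_cst y)).
  have sqt : {for rho, continuous (fun t : R => t ^+ 2)} by exact: exprn_continuous.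
  have Fneg : \forall t \near rho^'-, F (t, y) < 0.
    by apply: (cvgr_lt _ (cvg_at_left_filter Ft)).
  have Nlt : \forall t \near rho^'-, N y < t ^+ 2.
    by apply: (cvgr_gt _ (cvg_at_left_filter sqt)).
  near rho^'- => t.
  have t0 : 0 < t by near: t; exact: nbhs_left_gt.
  have trho : t < rho by near: t; exact: nbhs_left_lt.
  have : rho <= t.
    apply: (rhomin (t, y)); rewrite inE; split=> /=; first exact: ltW.
    - by apply: ltW; exact: lt_le_trans rhor.
    - by apply: ltW; near: t.
    - by apply: ltW; near: t.
  by rewrite leNgt trho.
(* On the rim the bound [above] is only available in the limit from inside. *)
have ux_ge0 : 0 <= u x + h * rho.
  rewrite leNgt; apply/negP => ux.
  pose L (t : R) := x + t *: (x0 - x).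
  have L0 : L 0 = x by rewrite /L scale0r addr0.
  have Lc : L t @[t --> (0 : R)^'+] --> x.
    by apply: cvg_at_right_filter; rewrite -[X in _ --> X]L0; exact: line_continuous.
  have uLc : u (L t) + h * rho @[t --> (0 : R)^'+] --> u x + h * rho.
    by apply: cvgD; [exact: cvg_comp Lc (uc _ Ax)|exact: cvg_cst].
  have Lneg : \forall t \near (0 : R)^'+, u (L t) + h * rho < 0.
    exact: cvgr_lt _ uLc _ ux.
  near (0 : R)^'+ => t.
  have t0 : 0 < t by near: t; exact: nbhs_right_gt.
  have t1 : t < 1 by near: t; exact: nbhs_right_lt.
  have : u (L t) + h * rho < 0 by near: t.
  rewrite ltNge => /negP; apply.
  apply: le_trans (above (L t) _); first exact: sqrtr_ge0.
  have -> : N (L t) = (1 - t) ^+ 2 * N x.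
    rewrite /N /L !dot2E !mxE.
    move: (x 0 0) (x 0 1) (x0 0 0) (x0 0 1) => *; ring.
  have [->|Nx0'] := eqVneq (N x) 0; first by rewrite mulr0 exprn_gt0.
  apply: lt_le_trans Nx.
  have Npos : 0 < N x by rewrite lt_neqAle eq_sym Nx0' N0.
  by rewrite gtr_pMl// expr_lt1//; lra.
have touch : (u x + h * rho) ^+ 2 + N x = rho ^+ 2.
  have : u x + h * rho <= Num.sqrt (rho ^+ 2 - N x) by rewrite -subr_le0.
  have Nrho : 0 <= rho ^+ 2 - N x by rewrite subr_ge0.
  rewrite -ler_sqr ?nnegrE ?sqrtr_ge0// sqr_sqrtr// => le.
  move: Nx; rewrite le_eqVlt => /predU1P[Nx|Nx].
    have : (u x + h * rho) ^+ 2 = 0.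
      by apply/eqP; rewrite eq_le sqr_ge0 andbT (le_trans le)// Nx subrr.
    by move=> ->; rewrite add0r.
  have := above x Nx.
  rewrite -ler_sqr ?nnegrE ?sqrtr_ge0// sqr_sqrtr// => ge.
  by lra.
have aboveS y : N y < rho ^+ 2 -> rho ^+ 2 <= (u y + h * rho) ^+ 2 + N y.
  move=> Ny; have := above y Ny.
  rewrite -ler_sqr ?nnegrE ?sqrtr_ge0 ?(le_trans _ (above y Ny)) ?sqrtr_ge0//.
  by rewrite sqr_sqrtr ?subr_ge0 ?(ltW Ny)// lerBlDr.
have := cap_contact Ao us upos ueq Ax rho_gt0 aboveS touch ux_ge0.
by rewrite leNgt Hh.
Unshelve. all: by end_near. Qed.

(** * Supporting lines of a strictly convex domain *)

Lemma exit_point (R : realType) (A : set 'rV[R]_2) (y x : 'rV[R]_2) :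
  open A -> A y -> ~ A x ->
  exists2 t : R, 0 < t <= 1 & boundary A (y + t *: (x - y)).
Proof.
move=> Ao Ay nAx.
pose L (t : R) := y + t *: (x - y).
have L0 : L 0 = y by rewrite /L scale0r addr0.
have L1 : L 1 = x by rewrite /L scale1r addrC subrK.
have Lc (t : R) : L s @[s --> t] --> L t.
  exact: line_continuous.
pose S := [set t : R | 0 <= t <= 1 /\ A (L t)].
have S0 : S 0 by rewrite /S/= L0 lexx ler01.
have Subd : has_ubound S by exists 1 => t [/andP[]].
have hS : has_sup S by split=> //; exists 0.
have t0 : 0 <= sup S by exact: ub_le_sup.
have t1 : sup S <= 1 by apply: ge_sup; [exists 0|move=> t [/andP[]]].
have nA : ~ A (L (sup S)).
  move=> At.
  have tlt1 : sup S < 1.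
    by rewrite lt_neqAle t1 andbT; apply/eqP => tE; apply: nAx; rewrite -L1 -tE.
  have Anear : \forall s \near (sup S)^'+, A (L s).
    apply: (cvg_at_right_filter (Lc (sup S))).
    exact: open_nbhs_nbhs.
  near (sup S)^'+ => s.
  have ts : sup S < s by near: s; exact: nbhs_right_gt.
  have : s <= sup S.
    apply: ub_le_sup => //; split; last by near: s.
    by rewrite (ltW (le_lt_trans t0 ts))/=; near: s; exact: nbhs_right_le.
  by rewrite leNgt ts.
exists (sup S); first by rewrite t1 andbT lt_neqAle t0 andbT; apply/eqP => tE;
  apply: nA; rewrite -tE L0.
split; last by rewrite (iffLR (interior_id A) Ao).
move=> B /(Lc (sup S)) /nbhs_ballP[e /= e0 eB].
have [s [s01 As] es] := sup_adherent e0 hS.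
exists (L s); split => //; apply: eB; rewrite /ball/=.
have : s <= sup S by exact: ub_le_sup.
by rewrite -subr_ge0 => /ger0_norm ->; lra.
Unshelve. all: by end_near. Qed.

Section strictly_convex.
Variables (R : realType) (A : set 'rV[R]_2).
Hypotheses (Ao : open A) (Ac : strictly_convex A).

(** In contrapositive form: a boundary point is no barycentre, with positive
    weights, of points of the closure one of which differs from it. *)
Lemma strictly_convex_comb2 (P Q G : 'rV[R]_2) (a b : R) :
  closure A P -> closure A Q -> P != G -> 0 < a -> 0 < b ->
  a *: (P - G) + b *: (Q - G) = 0 -> A G.
Proof.
move=> AP AQ PG a0 b0 abE.
have ab0 : 0 < a + b by exact: addr_gt0.
have abn : a + b != 0 by rewrite lt0r_neq0.
have GE : G = (a / (a + b)) *: P + (1 - a / (a + b)) *: Q.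
  have e0 := congr1 (fun v : 'rV[R]_2 => v 0 0) abE.
  have e1 := congr1 (fun v : 'rV[R]_2 => v 0 1) abE.
  move: e0 e1; rewrite !mxE => e0 e1.
  apply: row2P; rewrite !mxE; apply: (mulfI abn).
    by rewrite -[LHS]addr0 -e0; field.
  by rewrite -[LHS]addr0 -e1; field.
rewrite -(iffLR (interior_id A) Ao) GE; apply: Ac => //.
  apply: contra_neq PG => PQ; rewrite GE -PQ -scalerDl.
  by rewrite addrC subrK scale1r.
by rewrite divr_gt0//= ltr_pdivrMr// mul1r ltrDl.
Qed.

Lemma strictly_convex_comb3 (P Q S G : 'rV[R]_2) (a b c : R) :
  closure A P -> closure A Q -> closure A S -> P != G ->
  0 < a -> 0 < b -> 0 < c ->
  a *: (P - G) + (b *: (Q - G) + c *: (S - G)) = 0 -> A G.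
Proof.
move=> AP AQ AS PG a0 b0 c0 abcE.
have bc0 : 0 < b + c by exact: addr_gt0.
have bcn : b + c != 0 by rewrite lt0r_neq0.
pose M := (b / (b + c)) *: Q + (1 - b / (b + c)) *: S.
have AM : closure A M.
  have [QS|QS] := eqVneq Q S.
    by rewrite /M QS -scalerDl addrC subrK scale1r -QS.
  apply: subset_closure; apply: interior_subset; apply: Ac => //.
  by rewrite divr_gt0//= ltr_pdivrMr// mul1r ltrDl.
apply: (@strictly_convex_comb2 P M G a (b + c)) => //.
rewrite -abcE; congr (_ + _).
by apply: row2P; rewrite !mxE; field.
Qed.

End strictly_convex.

Section support.
Variables (R : realType) (A : set 'rV[R]_2) (g : R -> 'rV[R]_2) (l : R).
Hypotheses (Ao : open A) (Ac : strictly_convex A) (gP : boundary_param A g l).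

Let T (t : R) : 'rV[R]_2 := derive1 g t.
Let N (t : R) : 'rV[R]_2 := rot90 (T t).

Lemma boundary_notin t : ~ A (g t).
Proof.
have [_ _ gr _] := gP.
have : boundary A (g t) by rewrite -gr; exists t.
by move=> [_]; rewrite (iffLR (interior_id A) Ao).
Qed.

Lemma boundary_closure t : closure A (g t).
Proof.
have [_ _ gr _] := gP.
have : boundary A (g t) by rewrite -gr; exists t.
by case.
Qed.

Lemma dot_tangent_gt0 t : 0 < dot (T t) (T t).
Proof.
have [_ [_ _ _ g'0] _ _] := gP.
rewrite lt_neqAle dot_ge0 andbT; apply: contra_neq (g'0 t) => /esym.
rewrite dot2E -!expr2 => e.
have := sqr_ge0 (T t 0 0); have := sqr_ge0 (T t 0 1) => h1 h0.
by apply: row2P; rewrite mxE; apply/eqP; rewrite -sqrf_eq0; apply/eqP; lra.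
Qed.

Lemma is_derive_g (i : 'I_2) (t : R) : is_derive t 1 (fun s => g s 0 i) (T t 0 i).
Proof. by apply: is_derive_coord; have [_ [] ] := gP. Qed.

Lemma is_derive_linear_g (a b t : R) :
  is_derive t 1 (fun s => a * g s 0 0 + b * g s 0 1)
    (a * T t 0 0 + b * T t 0 1).
Proof.
exact: is_derive_add (is_derive_scalel a (is_derive_g 0 t))
                     (is_derive_scalel b (is_derive_g 1 t)).
Qed.

(** A point [y] of the closure on the outer side of the tangent at [g t] would
    make [g t] a barycentre of [y], of an interior point on the inward normal
    and, unless [y] lies on the normal too, of a neighbouring boundary point
    on the side of the normal opposite to [y]. *)
Lemma support t y : closure A y -> 0 <= dot (y - g t) (N t).
Proof.
move=> Ay; rewrite leNgt; apply/negP => yN.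
have [_ _ _ gin] := gP.
near (0 : R)^'+ => s.
have s0 : 0 < s by near: s; exact: nbhs_right_gt.
have Az : A (g t + s *: N t) by near: s; exact: gin.
have Acz := subset_closure Az.
have yg : y != g t.
  apply: contraTneq yN => ->; rewrite dot2E !mxE !subrr !mul0r addr0.
  by rewrite ltxx.
have Tp := dot_tangent_gt0 t.
apply: (@boundary_notin t).
move: yN Tp; rewrite !dot2E !rot90E0 !rot90E1 !mxE => yN Tp.
(* The linear relation between three plane vectors whose coefficients are
   their cross products; [k] fixes the common sign. *)
have cross_comb k t' : let sg := g t' - g t in
    (k * (sg 0 0 * T t 0 0 + sg 0 1 * T t 0 1)) *: (y - g t) +
    ((- k * ((y - g t) 0 0 * T t 0 0 + (y - g t) 0 1 * T t 0 1)) *: (g t' - g t) +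
     (k * ((y - g t) 0 0 * sg 0 1 - (y - g t) 0 1 * sg 0 0) / s) *:
        (g t + s *: N t - g t)) = 0.
  have sn : s != 0 by rewrite lt0r_neq0.
  apply: row2P; rewrite /= !mxE ?eqxx/=; move: (T t 0 0) (T t 0 1)
    (g t 0 0) (g t 0 1) (g t' 0 0) (g t' 0 1) (y 0 0) (y 0 1) => *; by field.
pose m := (y 0 0 - g t 0 0) * T t 0 0 + (y 0 1 - g t 0 1) * T t 0 1.
pose phi s := T t 0 0 * g s 0 0 + T t 0 1 * g s 0 1.
pose psi s := - (y 0 1 - g t 0 1) * g s 0 0 + (y 0 0 - g t 0 0) * g s 0 1.
have phid : is_derive t 1 phi _ := is_derive_linear_g (T t 0 0) (T t 0 1) t.
have psid : is_derive t 1 psi _ :=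
  is_derive_linear_g (- (y 0 1 - g t 0 1)) (y 0 0 - g t 0 0) t.
have psi0 : 0 < - (y 0 1 - g t 0 1) * T t 0 0 + (y 0 0 - g t 0 0) * T t 0 1.
  by lra.
have [m0|m0|m0] := ltgtP m 0.
- have P := is_derive_gt0_right phid Tp.
  have Q := is_derive_gt0_right psid psi0.
  near t^'+ => t'.
  have phi_lt : phi t < phi t' by near: t'.
  have psi_lt : psi t < psi t' by near: t'.
  rewrite /phi in phi_lt; rewrite /psi in psi_lt.
  have := cross_comb 1 t'; rewrite /= !mxE.
  apply: strictly_convex_comb3 => //; first exact: boundary_closure.
  + by lra.
  + by move: m0; rewrite /m; lra.
  + by rewrite divr_gt0//; lra.
- have P := is_derive_gt0_left phid Tp.
  have Q := is_derive_gt0_left psid psi0.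
  near t^'- => t'.
  have phi_lt : phi t' < phi t by near: t'.
  have psi_lt : psi t' < psi t by near: t'.
  rewrite /phi in phi_lt; rewrite /psi in psi_lt.
  have := cross_comb (-1) t'; rewrite /= !mxE.
  apply: strictly_convex_comb3 => //; first exact: boundary_closure.
  + by lra.
  + by move: m0; rewrite /m; lra.
  + by rewrite divr_gt0//; lra.
- pose n := (y 0 0 - g t 0 0) * T t 0 1 - (y 0 1 - g t 0 1) * T t 0 0.
  apply: (@strictly_convex_comb2 R A Ao Ac y (g t + s *: N t) (g t)
    (s * (T t 0 0 * T t 0 0 + T t 0 1 * T t 0 1)) n) => //.
  + by rewrite mulr_gt0.
  + by rewrite /n; lra.
  + have m0' : (y 0 0 - g t 0 0) * T t 0 0 = - ((y 0 1 - g t 0 1) * T t 0 1).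
      by move: m0; rewrite /m; lra.
    rewrite /n; apply: row2P; rewrite !mxE ?eqxx/=;
    move: (T t 0 0) (T t 0 1) (g t 0 0) (g t 0 1) (y 0 0) (y 0 1) m0'
      => T0 T1 g0 g1 y0 y1 m0'.
      rewrite (_ : _ + _ = s * T0 * ((y0 - g0) * T0 + (y1 - g1) * T1)); last by ring.
      by rewrite m0' addNr mulr0.
    rewrite (_ : _ + _ = s * T1 * ((y0 - g0) * T0 + (y1 - g1) * T1)); last by ring.
    by rewrite m0' addNr mulr0.
Unshelve. all: by end_near. Qed.

Lemma support_strict t y : A y -> 0 < dot (y - g t) (N t).
Proof.
move=> Ay; have Tp := dot_tangent_gt0 t.
have Lc := cvg_at_right_filter (@line_continuous R 1 y (- N t) 0).
have Anear : \forall s \near (0 : R)^'+, A (y + s *: - N t).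
  by apply: Lc; apply: open_nbhs_nbhs; rewrite scale0r addr0.
near (0 : R)^'+ => s.
have s0 : 0 < s by near: s; exact: nbhs_right_gt.
have Az : A (y + s *: - N t) by near: s.
have := support t (subset_closure Az).
have := mulr_gt0 s0 Tp.
rewrite !dot2E !rot90E0 !rot90E1 !mxE/=; lra.
Unshelve. all: by end_near. Qed.

End support.

(** * The inner parallel curve and Blaschke's rolling theorem *)

(** Frenet's formula: with [(T0, T1) = g'] and [w = |g'|], the left-hand side
    is the derivative of the component of the unit normal along [n] and the
    right-hand side is minus the curvature times that of [g']. *)
Lemma frenet_algebra (R : realType) (T0 T1 dT0 dT1 n0 n1 w : R) :
  w != 0 -> w ^+ 2 = T0 ^+ 2 + T1 ^+ 2 ->
  (n0 * - dT1 + n1 * dT0) / w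
    - (n0 * - T1 + n1 * T0) * (T0 * dT0 + T1 * dT1) / w ^+ 3 =
  - ((dT0 * - T1 + dT1 * T0) / w ^+ 3 * (T0 * n0 + T1 * n1)).
Proof.
move=> w0 wE.
have divwE (z : R) : z / w = z * (T0 ^+ 2 + T1 ^+ 2) / w ^+ 3.
  by rewrite -wE; field.
rewrite divwE; move: (w ^+ 3)^-1 => k; ring.
Qed.

Lemma collinear (R : realType) (a0 a1 b0 b1 : R) :
  a0 * - b1 + a1 * b0 = 0 -> 0 < b0 * b0 + b1 * b1 ->
  exists k, a0 = k * b0 /\ a1 = k * b1.
Proof.
move=> ab bb; exists ((a0 * b0 + a1 * b1) / (b0 * b0 + b1 * b1)).
have D0 : b0 * b0 + b1 * b1 != 0 by rewrite lt0r_neq0.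
split; apply: (mulIf D0).
  transitivity ((a0 * b0 + a1 * b1) * b0 - b1 * (a0 * - b1 + a1 * b0)).
    by ring.
  by rewrite ab; field.
transitivity ((a0 * b0 + a1 * b1) * b1 + b0 * (a0 * - b1 + a1 * b0)).
  by ring.
by rewrite ab; field.
Qed.

(** The point [(p, q)] is on the segment from [y] to [x], and the line through
    it with direction [(a, b)] has [y] on its inner side and [c] at distance at
    least [r] inside.  When [|x - c| < r], the Cauchy-Schwarz inequality puts
    [x] strictly inside as well, and the segment does not meet the line. *)
Lemma disc_inside_support (R : realType) (r w a b p q x0 x1 y0 y1 c0 c1 t : R) :
  0 <= r -> 0 < t -> t <= 1 -> 0 < w -> w ^+ 2 = a ^+ 2 + b ^+ 2 ->
  q = y1 + t * (x1 - y1) -> p = y0 + t * (x0 - y0) ->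
  0 < (y0 - p) * - b + (y1 - q) * a ->
  (x0 - c0) * (x0 - c0) + (x1 - c1) * (x1 - c1) < r ^+ 2 ->
  - b * p + a * q + r * w <= - b * c0 + a * c1 -> False.
Proof.
move=> r0 t0 t1 w0 wE qE pE yin xin sup.
pose L := - b * (x0 - c0) + a * (x1 - c1).
have Llt : - (r * w) < L.
  rewrite ltNge; apply/negP => Lle.
  have rw : (r * w) ^+ 2 <= L ^+ 2.
    rewrite -[leRHS]sqrrN ler_sqr ?nnegrE; first by lra.
      by rewrite mulr_ge0// ltW.
    by have : 0 <= r * w by [rewrite mulr_ge0// ltW|]; lra.
  have cs : L ^+ 2 <= ((x0 - c0) * (x0 - c0) + (x1 - c1) * (x1 - c1)) * w ^+ 2.
    rewrite wE -subr_ge0.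
    rewrite (_ : _ - _ = ((x0 - c0) * a + (x1 - c1) * b) ^+ 2) ?sqr_ge0//.
    by rewrite /L; ring.
  have : ((x0 - c0) * (x0 - c0) + (x1 - c1) * (x1 - c1)) * w ^+ 2 < r ^+ 2 * w ^+ 2.
    by rewrite ltr_pM2r// exprn_gt0.
  by rewrite -exprMn ltNge (le_trans rw cs).
have xgt : 0 < - b * (x0 - p) + a * (x1 - q) by move: Llt; rewrite /L; lra.
have : 0 < (1 - t) * ((y0 - p) * - b + (y1 - q) * a) +
    t * (- b * (x0 - p) + a * (x1 - q)).
  by rewrite ltr_wpDl ?mulr_gt0// mulr_ge0 ?subr_ge0// ltW.
rewrite (_ : _ + _ = 0) ?ltxx// qE pE; ring.
Qed.

Section parallel_curve.
Variables (R : realType) (A : set 'rV[R]_2) (g : R -> 'rV[R]_2) (l r : R).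
Hypotheses (Ao : open A) (Ac : strictly_convex A) (gP : boundary_param A g l).
Hypotheses (kappa_gt0 : forall t, 0 < curvature g t).
Hypotheses (rk : forall t, r * curvature g t < 1).

(* Names for [g'] and [g''] that conversion does not unfold to limits. *)
Variables T dT : R -> 'rV[R]_2.
Hypotheses (TE : derive1 g = T) (dTE : derive1 T = dT).
Let N (t : R) : 'rV[R]_2 := rot90 (T t).
Let w (t : R) : R := enorm (T t).

Let w_gt0 t : 0 < w t.
Proof. by rewrite sqrtr_gt0 -TE (dot_tangent_gt0 gP). Qed.

Let is_derive_T (i : 'I_2) (t : R) : is_derive t 1 (fun s => T s 0 i) (dT t 0 i).
Proof. by rewrite -dTE -TE; apply: is_derive_coord; have [_ []] := gP. Qed.

(** The scalar product with [n] of [g t + r nu], where [nu = N t / w t] is the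
    inward unit normal. *)
Definition parallel_height (n : 'rV[R]_2) (t : R) : R :=
  n 0 0 * g t 0 0 + n 0 1 * g t 0 1 +
  r * ((w t)^-1 * (n 0 0 * - T t 0 1 + n 0 1 * T t 0 0)).

Lemma is_derive_parallel_height (n : 'rV[R]_2) (t : R) :
  is_derive t 1 (parallel_height n)
    ((1 - r * curvature g t) * (T t 0 0 * n 0 0 + T t 0 1 * n 0 1)).
Proof.
have jd : is_derive t 1 (fun s => n 0 0 * - T s 0 1 + n 0 1 * T s 0 0)
    (n 0 0 * - dT t 0 1 + n 0 1 * dT t 0 0).
  apply: is_derive_add; apply: is_derive_scalel; last exact: is_derive_T.
  exact: is_deriveN (is_derive_T 1 t).
have wE s : w s = Num.sqrt (0 + (T s 0 0 ^+ 2 + T s 0 1 ^+ 2)).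
  by rewrite /w /enorm dot2E add0r -!expr2.
have S0 : 0 < 0 + (T t 0 0 ^+ 2 + T t 0 1 ^+ 2).
  by rewrite add0r -sqr_enorm; exact: exprn_gt0 (w_gt0 t).
have wd := is_derive_over_slope S0 (is_derive_T 0 t) (is_derive_T 1 t) jd.
have gd := is_derive_linear_g gP (n 0 0) (n 0 1) t.
have -> : parallel_height n = (fun s => n 0 0 * g s 0 0 + n 0 1 * g s 0 1 +
    r * ((Num.sqrt (0 + (T s 0 0 ^+ 2 + T s 0 1 ^+ 2)))^-1 *
         (n 0 0 * - T s 0 1 + n 0 1 * T s 0 0))).
  by apply/funext => s; rewrite /parallel_height wE.
apply: is_derive_eq (is_derive_add gd (is_derive_scalel r wd)) _.
rewrite /= -wE frenet_algebra ?lt0r_neq0// ?sqr_enorm//.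
rewrite /curvature dot2E rot90E0 rot90E1 TE dTE -/(w t).
move: (_ / _) => k.
move: (T t 0 0) (T t 0 1) (n 0 0) (n 0 1) => *; ring.
Qed.

(** At a minimum [c] the tangent is [k] times that at [t].  If [k > 0], then
    [N t] is normal at [c] too and [g c] is on the inner side of the tangent
    at [t].  If [k < 0], then convexity of the curve makes [g], and with it
    the parallel curve, turn towards smaller heights after [c]. *)
Lemma parallel_height_min t s :
  parallel_height (N t) t <= parallel_height (N t) s.
Proof.
have [[l0 gl _] _ _ _] := gP.
have Tl : periodic T l by rewrite -TE; exact: derive1_periodic.
have ml : periodic (parallel_height (N t)) l.
  by move=> z; rewrite /parallel_height /w gl Tl.
have mc : continuous (parallel_height (N t)).
  move=> z; apply/differentiable_continuous/derivable1_diffP.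
  exact: (ex_derive (is_derive := is_derive_parallel_height (N t) z)).
have [c cmin] := periodic_min l0 ml mc.
apply: (le_trans _ (cmin s)).
have kc z : 0 < 1 - r * curvature g z by rewrite subr_gt0.
have dc0 : T c 0 0 * N t 0 0 + T c 0 1 * N t 0 1 = 0.
  have D0 : is_derive c 1 (parallel_height (N t)) 0.
    apply: (@derive1_at_min _ _ (c - 1) (c + 1)).
    - lra.
    - by move=> z _; exact: (ex_derive (is_derive := is_derive_parallel_height (N t) z)).
    - by rewrite in_itv/=; apply/andP; split; lra.
    - by move=> z _; exact: cmin.
  have : (1 - r * curvature g c) * (T c 0 0 * N t 0 0 + T c 0 1 * N t 0 1) = 0.
    have [_ <-] := is_derive_parallel_height (N t) c.
    by case: D0.
  by move/eqP; rewrite mulf_eq0 gt_eqF//= => /eqP.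
have Tt := dot_tangent_gt0 gP t; have Tc := dot_tangent_gt0 gP c.
rewrite TE dot2E in Tt; rewrite TE dot2E in Tc.
rewrite /N rot90E0 rot90E1 in dc0.
have [k [Tc0 Tc1]] := collinear dc0 Tt.
have [k0|k0|k0] := ltgtP k 0.
- exfalso.
  have jd : is_derive c 1 (fun s => T s 0 0 * N t 0 0 + T s 0 1 * N t 0 1)
      (dT c 0 0 * N t 0 0 + dT c 0 1 * N t 0 1).
    have cT (i : 'I_2) (v : R) :
        is_derive c 1 (fun s => T s 0 i * v) (dT c 0 i * v).
      have := is_derive_mul (is_derive_T i c) (is_derive_const c v).
      by rewrite mulr0 add0r mulrC.
    exact: is_derive_add (cT 0 _) (cT 1 _).
  have Njd := is_deriveN jd.
  have dj0 : 0 < - (dT c 0 0 * N t 0 0 + dT c 0 1 * N t 0 1).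
    have := kappa_gt0 c; rewrite /curvature TE dTE -/(w c).
    rewrite pmulr_lgt0 ?invr_gt0 ?exprn_gt0// dot2E rot90E0 rot90E1 Tc0 Tc1.
    rewrite /N rot90E0 rot90E1.
    move: (dT c 0 0) (dT c 0 1) (T t 0 0) (T t 0 1) => a0 a1 b0 b1.
    have -> : a0 * - (k * b1) + a1 * (k * b0) = (- k) * - (a0 * - b1 + a1 * b0).
      by ring.
    by rewrite pmulr_rgt0 ?oppr_gt0.
  have jpos := is_derive_gt0_right Njd dj0.
  pose dm s := (1 - r * curvature g s) * (T s 0 0 * N t 0 0 + T s 0 1 * N t 0 1).
  have md : \forall s \near c, is_derive (s : R) 1 (- parallel_height (N t)) ((- dm) s).
    by near=> z; apply: is_deriveN; exact: is_derive_parallel_height.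
  have dmpos : \forall s \near c^'+, 0 < (- dm) s.
    apply: filterS jpos => z; rewrite !fctE /dm /N !rot90E0 !rot90E1.
    rewrite dc0 oppr0 => jz.
    by rewrite -mulrN pmulr_rgt0 ?subr_gt0//; move: jz.
  have inc := derive_gt0_right_lt md dmpos.
  near c^'+ => z.
  have : (- parallel_height (N t)) c < (- parallel_height (N t)) z by near: z.
  by rewrite !fctE ltrN2 ltNge cmin.
- have := support Ao Ac gP t (@boundary_closure _ _ _ _ gP c).
  rewrite TE dot2E rot90E0 rot90E1 !mxE => sup_t.
  have wc : w c = k * w t.
    apply/eqP; rewrite -(@eqrXn2 _ 2)//; [|exact: ltW|by rewrite mulr_ge0 ?ltW].
    rewrite exprMn !sqr_enorm Tc0 Tc1; apply/eqP.
    by move: (T t 0 0) (T t 0 1) => *; ring.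
  rewrite /parallel_height wc Tc0 Tc1 /N rot90E0 rot90E1.
  have -> : (k * w t)^-1 *
     (- T t 0 1 * - (k * T t 0 1) + T t 0 0 * (k * T t 0 0)) =
     (w t)^-1 * (- T t 0 1 * - T t 0 1 + T t 0 0 * T t 0 0).
    have kn : k != 0 by rewrite lt0r_neq0.
    have wn : w t != 0 by rewrite lt0r_neq0.
    move: (T t 0 0) (T t 0 1) (w t) wn => * .
    by field; apply/andP.
  by rewrite lerD2r; lra.
- by move: Tc; rewrite Tc0 Tc1 k0 !mul0r addr0 ltxx.
Unshelve. all: by end_near. Qed.

(** Blaschke's rolling theorem, for the disc touching the curve at [g 0]. *)
Lemma inner_disc : 0 <= r -> A !=set0 ->
  exists x0, forall x, dot (x - x0) (x - x0) < r ^+ 2 -> A x.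
Proof.
move=> r0 [y Ay]; pose nu := (w 0)^-1 *: N 0.
exists (g 0 + r *: nu) => x xr; apply: contrapT => nAx.
have [t /andP[t0 t1]] := exit_point Ao Ay nAx.
have [_ _ <- _] := gP; move=> [s _ gs].
have ys := support_strict Ao Ac gP s Ay.
have := parallel_height_min s 0.
rewrite /parallel_height.
move: ys xr; rewrite /nu !dot2E TE !mxE/=.
have := congr1 (fun v : 'rV[R]_2 => v 0 0) gs.
have := congr1 (fun v : 'rV[R]_2 => v 0 1) gs.
rewrite !mxE.
have wsE : w s ^+ 2 = T s 0 0 ^+ 2 + T s 0 1 ^+ 2 by rewrite sqr_enorm.
move: wsE; have := w_gt0 s; have := w_gt0 0.
move: (w s) (w 0) (T s 0 0) (T s 0 1) (T 0 0 0) (T 0 0 1).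
move: (g s 0 0) (g s 0 1) (g 0 0 0) (g 0 0 1).
move=> p q g0 g1 ws w0 a b a0 b0 w00 ws0 wsE qE pE yin xin sup.
apply: (disc_inside_support r0 t0 t1 ws0 wsE qE pE yin xin).
have wsn : ws != 0 by rewrite lt0r_neq0.
rewrite (_ : r * ws = r * (ws^-1 * (- b * - b + a * a))); last first.
  rewrite (_ : _ + _ = ws ^+ 2); last by rewrite wsE; ring.
  by field.
move: sup; move: (ws^-1) (w0^-1) => iw iw0.
lra.
Qed.

End parallel_curve.

(** * The estimate *)

Lemma has_ubound_image (R : realType) (n : nat) (A : set 'rV[R]_n)
    (u : 'rV[R]_n -> R) : bounded_set A ->
  {within closure A, continuous u} -> has_ubound [set u x | x in A].
Proof.
move=> Ab uc.
have [->|/set0P[x0 Ax0]] := eqVneq A set0.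
  by exists 0 => _ [x []].
have cA : compact (closure A).
  apply: bounded_closed_compact; last exact: closed_closure.
  have [M [Mr AM]] := Ab; exists M; split=> // m Mm x /= xA.
  rewrite -subr_le0.
  apply: (@closure_le0 _ _ _ (fun y : 'rV[R]_n => `|y| - m) _ xA).
    by apply: continuousB; [exact: norm_continuous|exact: cst_continuous].
  by move=> y Ay; rewrite subr_le0; exact: AM.
have [|c _ cmax] := compact_EVT_max _ cA uc.
  by exists x0; exact: subset_closure.
by exists (u c) => _ [x Ax <-]; apply: cmax; rewrite inE; exact: subset_closure.
Qed.

Theorem theorem4p1 (R : realType) (Omega : set 'rV[R]_2)
    (gamma : R -> 'rV[R]_2) (l a H : R) (u : 'rV[R]_2 -> R)
    (Omega_domain : domain Omega)
    (Omega_bounded : bounded_set Omega)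
    (Omega_convex : strictly_convex Omega)
    (gammaP : boundary_param Omega gamma l)
    (kappa_gt0 : forall t, 0 < curvature gamma t)
    (a_gt0 : 0 < a)
    (H_lt1 : H < 1)
    (uP : dirichlet_solution Omega H a u) :
  (1 - H) / max_curvature gamma <= sup [set u x | x in Omega].
Proof.
have [Oo _ O0] := Omega_domain.
have [us uc upos ueq _] := uP.
have [[t0 t0E] kmax] := max_curvature_attained gammaP.
set k := max_curvature gamma in t0E kmax *.
have k0 : 0 < k by rewrite -t0E.
have kn : k != 0 by rewrite lt0r_neq0.
pose C := (1 - H) / k.
(* The disc has radius [th / k], the caps sweep it up to [th ^+ 2 / k], and
   [1 - h = th * (1 - H)]; each factor [th < 1] makes one inequality strict. *)
have scaled (th : R) : 0 < th < 1 ->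
    th ^+ 3 * C <= sup [set u x | x in Omega].
  move=> /andP[th0 th1].
  have rk t : th / k * curvature gamma t < 1.
    apply: (@le_lt_trans _ _ th) => //.
    rewrite mulrAC ler_pdivrMr// ler_pM2l//; exact: kmax.
  have r0 : 0 < th / k by rewrite divr_gt0.
  have [x0 disc] := inner_disc Oo Omega_convex gammaP kappa_gt0 rk
    erefl erefl (ltW r0) O0.
  have r'0 : 0 < th ^+ 2 / k by rewrite divr_gt0// exprn_gt0.
  have sub y : dot (y - x0) (y - x0) <= (th ^+ 2 / k) ^+ 2 -> Omega y.
    move=> yx; apply: disc; apply: le_lt_trans yx _.
    rewrite ltr_sqr ?nnegrE ?ltW// ltr_pM2r ?invr_gt0// expr2 gtr_pMl//.
  have Hh : H < 1 - th * (1 - H).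
    have : th * (1 - H) < 1 - H by rewrite gtr_pMl// subr_gt0.
    by lra.
  have := sweep_caps Oo us upos ueq Hh r'0 sub.
  have -> : (1 - (1 - th * (1 - H))) * (th ^+ 2 / k) = th ^+ 3 * C.
    by rewrite /C; field.
  move=> /ltW/le_trans; apply; apply: ub_le_sup.
    exact: has_ubound_image.
  exists x0 => //; apply: sub.
  by rewrite subrr dot2E !mxE !mul0r addr0 sqr_ge0.
rewrite leNgt; apply/negP => SC; rewrite -/C in SC.
have cube : th ^+ 3 * C @[th --> (1 : R)^'-] --> C.
  apply: cvg_at_left_filter.
  have e3 : {for (1 : R), continuous (fun th : R => th ^+ 3)}.
    exact: exprn_continuous.
  have eC : (1 : R) ^+ 3 * C = C by rewrite expr1n mul1r.
  rewrite -[X in _ --> X]eC.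
  exact: (continuousM e3 (@cst_continuous _ _ C (1 : R))).
have close : \forall th \near (1 : R)^'-, sup [set u x | x in Omega] < th ^+ 3 * C.
  exact: cvgr_gt _ cube _ SC.
near (1 : R)^'- => th.
have : sup [set u x | x in Omega] < th ^+ 3 * C by near: th.
rewrite ltNge scaled//; apply/andP; split; near: th.
  exact: nbhs_left_gt.
exact: nbhs_left_lt.
Unshelve. all: by end_near. Qed.
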